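(* Let $n\ge 2$ be an integer and $\lambda=\frac{n-1}{2}$. Let $x,y\in\mathbb{R}^{n+1}\setminus\{0\}$ be such that $1-2\langle x,y\rangle+|x|^2|y|^2\neq 0$, and set $r=|x||y|$, $w=\frac{\langle x,y\rangle}{|x||y|}$. Then the (extended) Poisson kernel $P$ of $\mathbb{R}^{n+1}$ is given by $$P(x,y)=\left(1+\frac{r}{\lambda}\,\partial_r\right)\left(\mathcal{K}\exp(-\langle y,\nabla_x\rangle)\mathcal{K}\right)[1],$$ where $(\mathcal{K}\exp(-\langle y,\nabla_x\rangle)\mathcal{K})[1]$ depends on $(x,y)$ only through $(r,w)$ and $\partial_r$ is the partial derivative with respect to $r$ at fixed $w$.
   Context: $\langle\cdot,\cdot\rangle$ and $|\cdot|$ are the Euclidean inner product and norm on $\mathbb{R}^{n+1}$. The Kelvin inversion with respect to $x$ is $\mathcal{K}[f](x)=\frac{1}{|x|^{n-1}}f\left(\frac{x}{|x|^2}\right)$. $\langle y,\nabla_x\rangle=\sum_j y_j\partial_{x_j}$, and its exponential $\exp(-\langle y,\nabla_x\rangle)$ is interpreted as the translation operator $\exp(-\langle y,\nabla_x\rangle)f(x)=f(x-y)$. $1$ denotes the constant function. The (extended) Poisson kernel of $\mathbb{R}^{N}$ (here $N=n+1$) is $$P(x,y)=\frac{1-|x|^2|y|^2}{(1-2\langle x,y\rangle+|x|^2|y|^2)^{N/2}},$$ defined for all $x,y\in\mathbb{R}^N$ for which the denominator is nonzero. *)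

(* Defs.v *)
From HB Require Import structures.
From mathcomp Require Import all_boot all_order all_algebra.
From mathcomp Require Import all_classical all_reals all_analysis.
Set Implicit Arguments.
Unset Strict Implicit.
Unset Printing Implicit Defensive.
Import Order.TTheory GRing.Theory Num.Theory.
Import numFieldNormedType.Exports.
Local Open Scope ring_scope.

(* The norm [`|x|] that the library puts on ['rV[R]_N] is the sup norm, so the
   Euclidean inner product and norm are introduced here. *)
Definition edot (R : realType) (N : nat) (x y : 'rV[R]_N) : R :=
  \sum_(i < N) x ord0 i * y ord0 i.

Definition enorm (R : realType) (N : nat) (x : 'rV[R]_N) : R :=
  Num.sqrt (edot x x).

Definition poisson_base (R : realType) (N : nat) (x y : 'rV[R]_N) : R :=
  1 - 2 * edot x y + enorm x ^+ 2 * enorm y ^+ 2.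

Definition poisson_kernel (R : realType) (N : nat) (x y : 'rV[R]_N) : R :=
  (1 - enorm x ^+ 2 * enorm y ^+ 2) / (poisson_base x y `^ (N%:R / 2)).

(* At [x = 0] the value is a junk one, coming from [0^-1 = 0]. *)
Definition kelvin (R : realType) (n : nat) (f : 'rV[R]_n.+1 -> R) :
    'rV[R]_n.+1 -> R :=
  fun x => (enorm x ^+ (n - 1))^-1 * f ((enorm x ^+ 2)^-1 *: x).

(* The operator exp(- <y, nabla_x>), interpreted as a translation. *)
Definition exp_translation (R : realType) (N : nat) (y : 'rV[R]_N)
    (f : 'rV[R]_N -> R) : 'rV[R]_N -> R :=
  fun x => f (x - y).

Definition kelvin_exp_kelvin_one (R : realType) (n : nat)
    (x y : 'rV[R]_n.+1) : R :=
  kelvin (exp_translation y (kelvin (fun=> 1))) x.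

Definition rvar (R : realType) (N : nat) (x y : 'rV[R]_N) : R :=
  enorm x * enorm y.

Definition wvar (R : realType) (N : nat) (x y : 'rV[R]_N) : R :=
  edot x y / (enorm x * enorm y).

Definition admissible (R : realType) (N : nat) (x y : 'rV[R]_N) : Prop :=
  [/\ x != 0, y != 0 & poisson_base x y != 0].

(* [G] expresses [F] as a function of (r, w) alone. The points where [F] is
   not defined mathematically (x = 0, or x/|x|^2 = y, i.e. a vanishing
   [poisson_base]) are left out, as is y = 0, where w makes no sense. *)
Definition expressed_in_rw (R : realType) (N : nat)
    (F : 'rV[R]_N -> 'rV[R]_N -> R) (G : R -> R -> R) : Prop :=
  forall x y : 'rV[R]_N, admissible x y -> F x y = G (rvar x y) (wvar x y).

(* The operator 1 + (r / lambda) d/dr, with w fixed. *)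
Definition one_plus_rdr (R : realType) (lambda : R) (G : R -> R -> R)
    (r w : R) : R :=
  G r w + r / lambda * derive1 (fun s : R => G s w) r.

(* Main.v *)
Require Import Defs.
From HB Require Import structures.
From mathcomp Require Import all_boot all_order all_algebra.
From mathcomp Require Import all_classical all_reals all_analysis.
From mathcomp Require Import ring lra.
Set Implicit Arguments.
Unset Strict Implicit.
Unset Printing Implicit Defensive.
Import Order.TTheory GRing.Theory Num.Theory.
Import numFieldNormedType.Exports.
Local Open Scope ring_scope.

(** Since [|x/|x|^2 - y|^2 = (1 - 2<x,y> + |x|^2|y|^2) / |x|^2], the powers of
    [|x|] produced by the two inversions cancel and
    [(K exp(-<y,nabla>) K)[1] = (1 - 2rw + r^2)^(-lambda)].  Applying
    [1 + (r/lambda) d/dr] to this function gives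
    [(1 - 2rw + r^2 - 2r(r - w)) / (1 - 2rw + r^2)^(lambda+1)]. *)

Section EuclideanProduct.
Context (R : realType) (N : nat).
Implicit Types x y z : 'rV[R]_N.

Lemma edotC x y : edot x y = edot y x.
Proof. by apply: eq_bigr => i _; rewrite mulrC. Qed.

Lemma edotZl a x y : edot (a *: x) y = a * edot x y.
Proof. by rewrite /edot mulr_sumr; apply: eq_bigr => i _; rewrite mxE mulrA. Qed.

Lemma edotBl x y z : edot (x - y) z = edot x z - edot y z.
Proof.
by rewrite /edot -sumrB; apply: eq_bigr => i _; rewrite !mxE mulrBl.
Qed.

Lemma edot_ge0 x : 0 <= edot x x.
Proof. by apply: sumr_ge0 => i _; rewrite -expr2 sqr_ge0. Qed.

Lemma edot_gt0 x : x != 0 -> 0 < edot x x.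
Proof.
move=> x0; rewrite lt_def edot_ge0 andbT; apply: contra x0 => /eqP xx0.
apply/eqP/rowP => i; rewrite mxE; apply/eqP; rewrite -sqrf_eq0 expr2.
by apply/eqP/(psumr_eq0P _ xx0) => // j _; rewrite -expr2 sqr_ge0.
Qed.

Lemma enorm_gt0 x : x != 0 -> 0 < enorm x.
Proof. by move=> /edot_gt0; rewrite sqrtr_gt0. Qed.

Lemma sqr_enorm x : enorm x ^+ 2 = edot x x.
Proof. exact/sqr_sqrtr/edot_ge0. Qed.

Lemma enormZ a x : 0 <= a -> enorm (a *: x) = a * enorm x.
Proof.
move=> a0; rewrite /enorm edotZl edotC edotZl mulrA -expr2.
by rewrite sqrtrM ?sqr_ge0// sqrtr_sqr ger0_norm.
Qed.

Lemma edot_inversionB x y : x != 0 ->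
  edot ((enorm x ^+ 2)^-1 *: x - y) ((enorm x ^+ 2)^-1 *: x - y) =
  poisson_base x y / enorm x ^+ 2.
Proof.
move=> /enorm_gt0 x0; rewrite /poisson_base edotBl edotZl.
rewrite ![edot _ (_ - _)]edotC !edotBl !edotZl [edot y x]edotC -!sqr_enorm.
by field; rewrite gt_eqF.
Qed.

(** By [edot_inversionB] the base is a squared Euclidean norm times [enorm x ^+ 2]. Hence a nonzero
    base is positive, which the square roots and real powers below rely on. *)
Lemma poisson_base_ge0 x y : x != 0 -> 0 <= poisson_base x y.
Proof.
move=> x0; have := edot_ge0 ((enorm x ^+ 2)^-1 *: x - y).
by rewrite edot_inversionB// pmulr_lge0// invr_gt0 exprn_gt0// enorm_gt0.
Qed.

Lemma poisson_base_rw x y : x != 0 -> y != 0 ->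
  poisson_base x y = 1 - 2 * rvar x y * wvar x y + rvar x y ^+ 2.
Proof.
move=> /enorm_gt0 x0 /enorm_gt0 y0; rewrite /poisson_base /rvar /wvar.
by field; rewrite !gt_eqF.
Qed.

End EuclideanProduct.

Lemma kelvin_exp_kelvin_oneE (R : realType) (n : nat) (x y : 'rV[R]_n.+1) :
  x != 0 ->
  kelvin_exp_kelvin_one x y = Num.sqrt (poisson_base x y) ^- (n - 1).
Proof.
move=> x0; have nx := enorm_gt0 x0.
rewrite /kelvin_exp_kelvin_one /kelvin /exp_translation mulr1.
have -> : enorm ((enorm x ^+ 2)^-1 *: x - y) =
          Num.sqrt (poisson_base x y) / enorm x.
  rewrite {1}/enorm edot_inversionB// sqrtrM ?poisson_base_ge0//.
  by rewrite sqrtrV ?sqr_ge0// sqrtr_sqr gtr0_norm.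
by rewrite -invfM -exprMn mulrCA divff ?mulr1// gt_eqF.
Qed.

Section RadialProfile.
Context (R : realType).
Implicit Types r w : R.

(** For [m] equal to 2 lambda > 0 and small [r], this is the generating function of the Gegenbauer
    polynomials C_k^lambda(w). Since 2 lambda is a natural number, an integer power of a square root
    stands for the real power. *)
Definition radial_profile (m : nat) r w : R :=
  Num.sqrt (1 - 2 * r * w + r ^+ 2) ^- m.

Lemma is_derive_poisson_quadratic r w :
  is_derive r 1 (fun s => 1 - 2 * s * w + s ^+ 2) (2 * (r - w)).
Proof.
(* Written as an algebraic combination of [cst] and [id], the function has a derivative that
   instance inference can compute. *)
have -> : (fun s => 1 - 2 * s * w + s ^+ 2) =
          cst 1 - (2 * w) *: id + id ^+ 2 :> (R -> R).
  by apply/funext => s; rewrite !fctE /GRing.scale/=; ring.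
apply: is_derive_eq; rewrite /GRing.scale/=; ring.
Qed.

(** Chain rule: with c the square root of the quadratic, c' = (r - w) / c and (c^-m)' = - m c' /
    c^(m+1), whence the exponent [m.+2]. Positivity keeps c away from 0, where neither the root nor
    the inverse is differentiable. *)
Lemma is_derive_radial_profile (m : nat) r w :
  0 < 1 - 2 * r * w + r ^+ 2 ->
  is_derive r 1 (fun s => radial_profile m s w)
    (- m%:R * (r - w) / Num.sqrt (1 - 2 * r * w + r ^+ 2) ^+ m.+2).
Proof.
move=> b0.
pose b s : R := 1 - 2 * s * w + s ^+ 2.
have db : is_derive r 1 b (2 * (r - w)) by exact: is_derive_poisson_quadratic.
have dsb : is_derive r 1 (Num.sqrt \o b)
    ((2 * Num.sqrt (b r))^-1 * (2 * (r - w))).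
  by apply: is_derive1_comp; exact: is_derive1_sqrt.
have sb0 : Num.sqrt (b r) != 0 by rewrite gt_eqF// sqrtr_gt0.
have -> : (fun s => radial_profile m s w) =
          (fun s => (((Num.sqrt \o b) ^+ m) s)^-1).
  by apply/funext => s; rewrite exprfctE.
have fm0 : ((Num.sqrt \o b) ^+ m) r != 0 by rewrite exprfctE expf_neq0.
apply: (is_derive_eq (is_deriveV fm0 (is_deriveX m dsb))).
rewrite exprfctE /GRing.scale/= -/(b r).
(* The power rule produces the exponent [m.-1], so the constant case [m = 0] is split off before
   simplifying. *)
case: m {fm0} => [|m]; first by rewrite !(mul0r, mulr0, oppr0).
by rewrite /= !exprS; field; rewrite sb0 expf_neq0.
Qed.

Lemma one_plus_rdr_radial_profile (n : nat) r w : (2 <= n)%N ->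
  0 < 1 - 2 * r * w + r ^+ 2 ->
  one_plus_rdr ((n%:R - 1) / 2) (radial_profile (n - 1)) r w =
  (1 - r ^+ 2) / Num.sqrt (1 - 2 * r * w + r ^+ 2) ^+ n.+1.
Proof.
(* Writing [n] as [m.+2] turns lambda into (m + 1) / 2, which is invertible and cancels the factor m
   + 1 coming from the derivative. *)
case: n => [|[|m]]// _ b0; rewrite /one_plus_rdr derive1E.
have /@derive_val -> := is_derive_radial_profile m.+1 b0.
rewrite subSS subn0 /radial_profile.
set c := Num.sqrt _; have c0 : c != 0 by rewrite gt_eqF// sqrtr_gt0.
(* This makes the goal a rational identity in which [c] is an atom, so that [field] applies. *)
have -> : 1 - r ^+ 2 = c ^+ 2 - 2 * r * (r - w).
  by rewrite sqr_sqrtr ?ltW//; ring.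
have m0 : m%:R + 1 != 0 :> R by rewrite natr1 pnatr_eq0.
have -> : m.+2%:R - 1 = m%:R + 1 :> R by rewrite -natr1 -natr1; ring.
by rewrite -natr1 !exprS; field; rewrite c0 m0 expf_neq0.
Qed.

End RadialProfile.

Lemma expressed_in_rw_radial_profile (R : realType) (n : nat) :
  expressed_in_rw (@kelvin_exp_kelvin_one R n) (radial_profile (n - 1)).
Proof.
by move=> x y [x0 y0 _]; rewrite kelvin_exp_kelvin_oneE// poisson_base_rw.
Qed.

(* [r] is varied at fixed [w] by moving [x] along its ray. *)
Lemma expressed_in_rw_near (R : realType) (n : nat) (G H : R -> R -> R)
    (x y : 'rV[R]_n.+1) (F : 'rV[R]_n.+1 -> 'rV[R]_n.+1 -> R) :
  expressed_in_rw F G -> expressed_in_rw F H -> admissible x y ->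
  \forall s \near rvar x y, G s (wvar x y) = H s (wvar x y).
Proof.
move=> FG FH [x0 y0 b0].
have [nx ny] := (enorm_gt0 x0, enorm_gt0 y0).
have r0 : 0 < rvar x y by rewrite mulr_gt0.
have b1 : 1 - 2 * rvar x y * wvar x y + rvar x y ^+ 2 != 0.
  by rewrite -poisson_base_rw.
(* Continuity keeps the base nonzero for [s] near [rvar x y], so the moved pair stays admissible. *)
have cb : {for rvar x y,
    continuous (fun s : R => 1 - 2 * s * wvar x y + s ^+ 2)}.
  apply/differentiable_continuous/derivable1_diffP.
  have dq := is_derive_poisson_quadratic (rvar x y) (wvar x y).
  exact: (@ex_derive _ _ _ _ _ _ _ dq).
near=> s.
have s0 : 0 < s by near: s; exact: lt_nbhsr.
(* The factor for which [t *: x] and [y] have radial variable exactly [s]; being positive, it leaves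
   [wvar] unchanged. *)
pose t := s / rvar x y.
have t0 : 0 < t by rewrite divr_gt0.
have tx0 : t *: x != 0 by rewrite scaler_eq0 negb_or x0 gt_eqF.
have rE : rvar (t *: x) y = s.
  by rewrite /rvar enormZ ?ltW// -mulrA divfK// gt_eqF.
have wE : wvar (t *: x) y = wvar x y.
  rewrite /wvar edotZl enormZ ?ltW//; field.
  by rewrite !gt_eqF.
have adm : admissible (t *: x) y.
  split=> //; rewrite poisson_base_rw// rE wE.
  by near: s; exact: (cvgr_neq0 _ cb b1).
by rewrite -rE -wE -FG// -FH.
Unshelve. all: by end_near. Qed.

Theorem corollary2p5 (R : realType) (n : nat) (hn : (2 <= n)%N) :
  (exists G : R -> R -> R, expressed_in_rw (@kelvin_exp_kelvin_one R n) G) /\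
  (forall G : R -> R -> R, expressed_in_rw (@kelvin_exp_kelvin_one R n) G ->
   forall x y : 'rV[R]_n.+1,
     x != 0 -> y != 0 ->
     1 - 2 * edot x y + enorm x ^+ 2 * enorm y ^+ 2 != 0 ->
     derivable (fun s : R => G s (wvar x y)) (rvar x y) 1 /\
     poisson_kernel x y
       = one_plus_rdr ((n%:R - 1) / 2) G (rvar x y) (wvar x y)).
Proof.
split.
  by exists (radial_profile (n - 1)); exact: expressed_in_rw_radial_profile.
move=> G FG x y x0 y0 b0.
have bE := poisson_base_rw x0 y0.
have bgt0 : 0 < poisson_base x y by rewrite lt_def b0 poisson_base_ge0.
have rwgt0 := bgt0; rewrite bE in rwgt0.
(* [G] is constrained only at values of (r, w) attained by admissible pairs. Agreement on a
   neighbourhood in r, not just at one point, is what transfers differentiability and the derivative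
   to [G]. *)
have near_eq : \forall s \near rvar x y,
    radial_profile (n - 1) s (wvar x y) = G s (wvar x y).
  apply: expressed_in_rw_near FG _ => //.
  exact: expressed_in_rw_radial_profile.
split.
  apply: near_eq_derivable near_eq _.
  exact/ex_derive/is_derive_radial_profile.
have -> : one_plus_rdr ((n%:R - 1) / 2) G (rvar x y) (wvar x y) =
    one_plus_rdr ((n%:R - 1) / 2) (radial_profile (n - 1)) (rvar x y) (wvar x y).
  rewrite /one_plus_rdr !derive1E (near_eq_derive _ near_eq).
  by rewrite (nbhs_singleton near_eq).
rewrite one_plus_rdr_radial_profile// -bE /poisson_kernel /rvar exprMn.
(* The real power with exponent (n + 1) / 2 is split as the power 1/2 followed by the integer power
   n + 1, which gives the power of [Num.sqrt] on the other side. *)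
by rewrite [_ / 2]mulrC powRrM powR_mulrn ?powR_ge0// powR12_sqrt ?ltW.
Qed.
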